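(* For every positive integer $n$, as formal power series (with the same choice of sign on both sides), $$\frac{\mathrm{BDes}_n^{D,\pm}(t)}{(1-t)^{n+1}}=\begin{cases}\displaystyle\sum_{k\ge0}\frac12\Big(\frac12\big((2k+1)^n+1\big)\pm1\Big)t^k & n\text{ even},\\[2mm] \displaystyle\sum_{k\ge0}\frac12\Big(\frac12\big((2k+1)^n+1\big)\pm(k+1)\Big)t^k & n\text{ odd},\end{cases}$$ $$\frac{\mathrm{BDes}_n^{B-D,\pm}(t)}{(1-t)^{n+1}}=\begin{cases}\displaystyle\sum_{k\ge0}\frac12\Big(\frac12\big((2k+1)^n-1\big)\Big)t^k & n\text{ even},\\[2mm] \displaystyle\sum_{k\ge0}\frac12\Big(\frac12\big((2k+1)^n-1\big)\pm k\Big)t^k & n\text{ odd}.\end{cases}$$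
   Context: $\mathfrak{B}_n$ is the group of signed permutations of $\{\pm1,\dots,\pm n\}$, written $\pi=\pi_1\cdots\pi_n$ with $\pi_i=\pi(i)$; $\mathrm{negs}(\pi)=|\{i:\pi_i<0\}|$, $\mathfrak{D}_n=\{\pi\in\mathfrak{B}_n:\mathrm{negs}(\pi)\text{ even}\}$. $\mathrm{inv}_D(\pi)=|\{1\le i<j\le n:\pi_i>\pi_j\}|+|\{1\le i<j\le n:-\pi_i>\pi_j\}|$. $\mathfrak{D}_n^{\pm}$ and $(\mathfrak{B}_n\setminus\mathfrak{D}_n)^{\pm}$ are the subsets of $\mathfrak{D}_n$, resp. $\mathfrak{B}_n\setminus\mathfrak{D}_n$, with $\mathrm{inv}_D$ even ($+$) or odd ($-$). With $\pi_0=0$, $\mathrm{des}_B(\pi)=|\{i\in\{0,\dots,n-1\}:\pi_i>\pi_{i+1}\}|$. $\mathrm{BDes}^{D,\pm}_n(t)=\sum_{\pi\in\mathfrak{D}_n^{\pm}}t^{\mathrm{des}_B(\pi)}$ and $\mathrm{BDes}^{B-D,\pm}_n(t)=\sum_{\pi\in(\mathfrak{B}_n\setminus\mathfrak{D}_n)^{\pm}}t^{\mathrm{des}_B(\pi)}$. *)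

(* Defs.v *)
From mathcomp Require Export all_boot all_order all_fingroup all_algebra.

Set Implicit Arguments.
Unset Strict Implicit.
Unset Printing Implicit Defensive.

Import Order.TTheory GRing.Theory Num.Theory.
Local Open Scope ring_scope.

(* The set {±1, ..., ±n}: the pair (b, i) stands for (-1)^b (i + 1).          *)
Notation letter n := (bool * 'I_n)%type.

Definition letter_val n (a : letter n) : int := (-1) ^+ a.1 * a.2.+1%:Z.

Definition letter_opp n (a : letter n) : letter n := (~~ a.1, a.2).

Lemma letter_valN n (a : letter n) : letter_val (letter_opp a) = - letter_val a.
Proof. by case: a => [[] i]; rewrite /letter_val /= !(expr0, expr1) ?mulN1r ?mul1r ?opprK. Qed.

Lemma letter_val_inj n : injective (@letter_val n).
Proof.
by case=> [[] i] [[] j]; rewrite /letter_val /= !(expr0, expr1) ?mulN1r ?mul1r;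
  first [move/oppr_inj | idtac] => // -[/val_inj ->].
Qed.

Definition signed_perms (n : nat) : {set {perm (letter n)}} :=
  [set p : {perm (letter n)} | [forall a, p (letter_opp a) == letter_opp (p a)]].

Lemma signed_perms_group_set n : group_set (signed_perms n).
Proof.
apply/group_setP; split=> [|p q].
  by rewrite inE; apply/forallP => a; rewrite !perm1.
rewrite !inE => /forallP pN /forallP qN; apply/forallP => a.
by rewrite !permM (eqP (pN a)) (eqP (qN _)).
Qed.
Canonical signed_perms_group n := Group (signed_perms_group_set n).

(* The one-line notation pi_1 ... pi_n, with pi_0 = 0.                         *)
Definition window n (p : {perm (letter n)}) : seq int :=
  [seq letter_val (p (false, i)) | i <- enum 'I_n].

Definition entry n (p : {perm (letter n)}) (i : nat) : int := (0 :: window p)`_i.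

(* In the statistics below an ordinal i : 'I_n stands for the position i + 1,
   except in des_B, where it stands for i itself.                              *)
Definition negs n (p : {perm (letter n)}) : nat :=
  #|[set i : 'I_n | entry p i.+1 < 0]|.

Definition inv_D n (p : {perm (letter n)}) : nat :=
  addn #|[set ij : 'I_n * 'I_n |
            (ij.1 < ij.2)%N && (entry p ij.1.+1 > entry p ij.2.+1)]|
       #|[set ij : 'I_n * 'I_n |
            (ij.1 < ij.2)%N && (- entry p ij.1.+1 > entry p ij.2.+1)]|.

Definition des_B n (p : {perm (letter n)}) : nat :=
  #|[set i : 'I_n | entry p i > entry p i.+1]|.

Definition Dn (n : nat) : {set {perm (letter n)}} :=
  [set p in signed_perms n | ~~ odd (negs p)].

(* A sign s : bool is + when false and - when true, so that its value is
   (-1) ^+ s; the superscript ± selects the p with odd (inv_D p) = s.          *)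
Definition with_sign n (s : bool) (A : {set {perm (letter n)}}) :=
  [set p in A | odd (inv_D p) == s].

Definition BDesD (n : nat) (s : bool) : {poly rat} :=
  \sum_(p in with_sign s (Dn n)) 'X ^+ des_B p.

Definition BDesBD (n : nat) (s : bool) : {poly rat} :=
  \sum_(p in with_sign s (signed_perms n :\: Dn n)) 'X ^+ des_B p.

(* Formal power series, given by their sequence of coefficients; they are to
   be compared with =1.                                                        *)
Section FormalPowerSeries.
Variable F : fieldType.

Definition fps := nat -> F.

Definition fps_of_poly (p : {poly F}) : fps := fun k => p`_k.

Definition fps_mul (f g : fps) : fps :=
  fun n => \sum_(i < n.+1) f i * g (n - i)%N.

(* The first n coefficients of the inverse of f, found by solving
   \sum_(i <= m) h_i f_(m - i) = [m = 0] successively for h_0, h_1, ...       *)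
Fixpoint fps_inv_coefs (f : fps) (n : nat) : seq F :=
  if n is m.+1 then
    let h := fps_inv_coefs f m in
    rcons h (((m == 0%N)%:R - \sum_(i < m) h`_i * f (m - i)%N) / f 0%N)
  else [::].

(* Meaningful only if f 0 != 0.                                                *)
Definition fps_inv (f : fps) : fps := fun n => (fps_inv_coefs f n.+1)`_n.

Definition fps_div (f g : fps) : fps := fps_mul f (fps_inv g).

Lemma size_fps_inv_coefs f n : size (fps_inv_coefs f n) = n.
Proof. by elim: n => //= n IHn; rewrite size_rcons IHn. Qed.

Lemma nth_fps_inv_coefs f n i :
  (i < n)%N -> (fps_inv_coefs f n)`_i = fps_inv f i.
Proof.
elim: n => // n IHn; rewrite ltnS leq_eqVlt => /predU1P[-> // | lt_in].
by rewrite /= nth_rcons size_fps_inv_coefs lt_in IHn.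
Qed.

Lemma fps_mulVf f : f 0%N != 0 ->
  fps_mul (fps_inv f) f =1 fps_of_poly 1.
Proof.
move=> f0 n; rewrite /fps_mul /fps_of_poly big_ord_recr /= subnn coef1.
rewrite {2}/fps_inv /= nth_rcons size_fps_inv_coefs ltnn eqxx divfK //.
under [X in _ - X]eq_bigr => i _ do rewrite nth_fps_inv_coefs //.
by rewrite addrC subrK.
Qed.

End FormalPowerSeries.

(* Main.v *)
Require Import Defs.
From mathcomp Require Import zify ring lra.
Import Order.TTheory GRing.Theory Num.Theory.
Local Open Scope ring_scope.

(* Expanding t^des_B(pi) / (1 - t)^(n + 1), its coefficient at t^k counts the sequences
   0 <= f_1 <= ... <= f_n <= k that are strict at the descents of 0 pi_1 ... pi_n.  Giving
   the letter |pi_i| the value f_i with the sign of pi_i, the pairs (pi, f) become the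
   vectors in [-k, k]^n, since pi is recovered from its vector by sorting.  The parity of
   inv_D is that of the inversions of |pi|, and it can be read off the vector as a product
   over pairs of coordinates.  Without this sign, the characters 1 and (-1)^negs have sums
   (2k + 1)^n and 1 over all vectors.  With it, exchanging two coordinates with distinct
   values reverses the sign, so the coordinates may be removed in pairs, which leaves 1 for
   n even and the case n = 1 for n odd.  The four sums combine to the theorem. *)

Set Implicit Arguments.
Unset Strict Implicit.

(** * Arithmetic of formal power series *)

Section FpsAlgebra.
Variable F : fieldType.
Implicit Types (f g h : fps F) (p q : {poly F}).

Lemma eq_fps_mul f f' g g' n :
    (forall i, (i <= n)%N -> f i = f' i) -> (forall i, (i <= n)%N -> g i = g' i) ->
  fps_mul f g n = fps_mul f' g' n.
Proof.
by move=> ff' gg'; apply: eq_bigr => i _; rewrite ff' ?gg' ?leq_subr // -ltnS.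
Qed.

Lemma fps_mul_poly p q : fps_mul (fps_of_poly p) (fps_of_poly q) =1 fps_of_poly (p * q).
Proof. by move=> n; rewrite /fps_of_poly coefM. Qed.

(** Coefficients of a product up to [n] depend only on those of the factors up to [n], so the ring
    laws are inherited from polynomials. *)
Let trunc n f : {poly F} := \poly_(i < n.+1) f i.

Let truncE n f i : (i <= n)%N -> f i = fps_of_poly (trunc n f) i.
Proof. by rewrite /fps_of_poly coef_poly ltnS => ->. Qed.

Let mul_truncE n f g i : (i <= n)%N ->
  fps_mul f g i = fps_of_poly (trunc n f * trunc n g) i.
Proof.
move=> le_in; rewrite -fps_mul_poly.
by apply: eq_fps_mul => j le_ji; apply/truncE/(leq_trans le_ji).
Qed.

Lemma fps_mulC f g : fps_mul f g =1 fps_mul g f.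
Proof. by move=> n; rewrite !(@mul_truncE n) // mulrC. Qed.

Lemma fps_mulA f g h : fps_mul f (fps_mul g h) =1 fps_mul (fps_mul f g) h.
Proof.
move=> n; transitivity (fps_of_poly (trunc n f * trunc n g * trunc n h) n).
  rewrite -mulrA -fps_mul_poly.
  by apply: eq_fps_mul => i le_in; [apply: truncE | apply: mul_truncE].
rewrite -fps_mul_poly; apply/esym.
by apply: eq_fps_mul => i le_in; [apply: mul_truncE | apply: truncE].
Qed.

Lemma fps_mulf1 f : fps_mul f (fps_of_poly 1) =1 f.
Proof.
move=> n; rewrite /fps_mul big_ord_recr /= subnn /fps_of_poly coef1 mulr1.
rewrite big1 ?add0r // => i _.
by rewrite coef1 subn_eq0 leqNgt ltn_ord mulr0.
Qed.

Lemma fps_div_unique f g h : g 0%N != 0 -> fps_mul h g =1 f -> fps_div f g =1 h.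
Proof.
move=> g0 hg n; rewrite /fps_div -[RHS]fps_mulf1.
rewrite (@eq_fps_mul _ (fps_mul h g) _ (fps_inv g)) // -fps_mulA.
by apply: eq_fps_mul => // i _; rewrite fps_mulC fps_mulVf.
Qed.

Lemma fps_div_sum (I : finType) (P : pred I) (c : I -> F) (p : I -> {poly F}) g n :
  fps_div (fps_of_poly (\sum_(i | P i) c i *: p i)) g n =
  \sum_(i | P i) c i * fps_div (fps_of_poly (p i)) g n.
Proof.
rewrite /fps_div /fps_mul; under [RHS]eq_bigr => i _ do rewrite mulr_sumr.
rewrite exchange_big; apply: eq_bigr => j _ /=.
rewrite /fps_of_poly coef_sum mulr_suml; apply: eq_bigr => i _.
by rewrite coefZ mulrA.
Qed.

Lemma fps_mulX f n :
  fps_mul f (fps_of_poly 'X) n = (if n is m.+1 then f m else 0).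
Proof.
rewrite fps_mulC /fps_mul /fps_of_poly big_ord_recl coefX mul0r add0r.
case: n => [|n]; first by rewrite big_ord0.
rewrite big_ord_recl coefX mul1r subSS subn0 big1 ?addr0 // => i _.
by rewrite coefX mul0r.
Qed.

Lemma fps_mul1BX f n :
  fps_mul f (fps_of_poly (1 - 'X)) n = f n - (if n is m.+1 then f m else 0).
Proof.
rewrite -fps_mulX -[f n]fps_mulf1 -sumrB.
by apply: eq_bigr => i _; rewrite -mulrBr /fps_of_poly coefB.
Qed.

End FpsAlgebra.

(** * Descents and division by powers of $1-t$ *)

Fixpoint ndes (z : int) (w : seq int) : nat :=
  if w is y :: w' then ((y < z)%R + ndes y w')%N else 0%N.

(* The number of sequences g >= f_1 >= f_2 >= ... of naturals, strict at the descents
   of z :: w. *)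
Fixpoint descsum (z : int) (w : seq int) (g : nat) : rat :=
  if w is y :: w' then \sum_(i < g.+1 - (y < z)%R) descsum y w' i else 1.

(** Multiplication by $1-t$ takes differences of the partial sums in [descsum]. This strips the
    first letter and leaves a factor $t$ exactly at a descent. *)
Lemma fps_mul_descsum z w :
  fps_mul (descsum z w) (fps_of_poly ((1 - 'X) ^+ (size w).+1))
    =1 fps_of_poly ('X ^+ ndes z w).
Proof.
elim: w z => [|y w IHw] z k /=.
  by rewrite fps_mul1BX /fps_of_poly coef1; case: k => [|k]; rewrite ?subr0 ?subrr.
rewrite exprS.
rewrite (@eq_fps_mul _ _ (descsum z (y :: w)) _
  (fps_mul (fps_of_poly (1 - 'X)) (fps_of_poly ((1 - 'X) ^+ (size w).+1)))) //;
  last by move=> i _; rewrite fps_mul_poly.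
rewrite fps_mulA.
rewrite (@eq_fps_mul _ _ (fps_mul (fps_of_poly ('X ^+ (y < z)%R)) (descsum y w))
  _ (fps_of_poly ((1 - 'X) ^+ (size w).+1))) //; last first.
  move=> i _; rewrite fps_mul1BX fps_mulC /=; case: (y < z); last first.
    rewrite expr0 fps_mulf1 subn0; case: i => [|i].
      by rewrite big_ord1 subr0.
    by rewrite subn0 big_ord_recr /= addrC addrK.
  rewrite expr1 fps_mulX subSS subn0; case: i => [|i]; first by rewrite big_ord0 subrr.
  by rewrite subSS subn0 big_ord_recr /= addrC addrK.
rewrite -fps_mulA exprD -fps_mul_poly; apply: eq_fps_mul => // i _; exact: IHw.
Qed.

Lemma fps_div_descsum z w :
  fps_div (fps_of_poly ('X ^+ ndes z w)) (fps_of_poly ((1 - 'X) ^+ (size w).+1))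
    =1 descsum z w.
Proof.
apply/fps_div_unique/fps_mul_descsum.
by rewrite /fps_of_poly -horner_coef0 horner_exp !hornerE expr1n oner_eq0.
Qed.

(** * Signed values encoded as ranks *)

Lemma sum_tuple_cons (R : nmodType) (T : finType) n (F : n.+1.-tuple T -> R) :
  \sum_t F t = \sum_x \sum_(t : n.-tuple T) F [tuple of x :: t].
Proof.
rewrite pair_big /= (reindex (fun xt : T * n.-tuple T => [tuple of xt.1 :: xt.2])) //=.
exists (fun t => (thead t, [tuple of behead t])) => [[x t] | t] _ /=.
  by rewrite theadE; congr (_, _); apply: val_inj.
by rewrite -tuple_eta.
Qed.

(* Ranks 0, 1, 2, 3, 4, ... stand for the values 0, -1, 1, -2, 2, ...; the absolute
   value of rank x is [uphalf x].  A sequence s of ranks fits the word w if it has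
   the signs of w, increases weakly, and increases strictly at the descents of w. *)
Fixpoint fits (z : int) (m : nat) (w : seq int) (s : seq nat) : bool :=
  match w, s with
  | y :: w', x :: s' =>
      [&& odd x == (y < 0), (m <= x)%N, (y < z) ==> (m < x)%N & fits y x w' s']
  | _, _ => true
  end.

(** The rank of sign [b] and absolute value [c] is $2c-b$; it exists only for $b \le c$, since there
    is no negative zero. *)
Lemma sum_ranks_of_sign k (b : bool) (P : pred nat) (F : nat -> rat) :
  \sum_(x < k.*2.+1 | (odd x == b) && P (uphalf x)) F (uphalf x) =
  \sum_(c < k.+1 | (b <= c)%N && P c) F c.
Proof.
rewrite (reindex_onto (fun c : 'I_k.+1 => inord (c.*2 - b) : 'I_k.*2.+1)
                      (fun x : 'I_k.*2.+1 => inord (uphalf x))) /=; last first.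
  move=> x /andP[/eqP odd_x _]; apply: val_inj; have := ltn_ord x.
  by rewrite /= -odd_x => ltx; rewrite !inordK; lia.
have E c : (c < k.+1)%N -> (b <= c)%N -> uphalf (@inord k.*2 (c.*2 - b)) = c.
  by move=> ltc leb; rewrite inordK; lia.
apply: eq_big => [c | c /andP[/andP[/eqP odd_c _] _]]; have ltc := ltn_ord c.
  case: (leqP b c) => [leb | ltb] /=.
    rewrite E // inord_val eqxx andbT inordK; last lia.
    by have -> : odd (c.*2 - b) == b by lia.
  (* Here truncated subtraction gives rank 0, which its even parity excludes. *)
  have [-> ->] : b = true /\ nat_of_ord c = 0%N by case: (b) ltb => //; lia.
  by rewrite inordK.
by rewrite E //; move: odd_c; rewrite inordK; lia.
Qed.

(** The decreasing values in [descsum] are $k$ minus the absolute values. With the signs fixed, the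
    required comparisons of ranks and of absolute values agree: passing from $\ge 0$ to negative is
    always a descent, passing back never is. *)
Lemma count_fits k z m w : (m <= k.*2)%N -> odd m = (z < 0) ->
  \sum_(s : (size w).-tuple 'I_k.*2.+1) (fits z m w (map val s))%:R
    = descsum z w (k - uphalf m).
Proof.
elim: w z m => [|y w IHw] z m le_m odd_m.
  rewrite (eq_bigr (fun=> 1)) => [|s _]; first by rewrite big_const card_tuple iter_addr_0.
  by case: (map val s).
rewrite sum_tuple_cons /=.
transitivity (\sum_(x < k.*2.+1 | (odd x == (y < 0)) && (uphalf m + (y < z)%R <= uphalf x)%N)
   descsum y w (k - uphalf x)).
  rewrite [RHS]big_mkcond; apply: eq_bigr => x _ /=.
  case: ifP => [/andP[/eqP odd_x le_x] | cond].
    rewrite -IHw //; last by rewrite -ltnS.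
    apply: eq_bigr => s _; rewrite odd_x eqxx /=.
    suff [-> ->] : (m <= x)%N /\ ((y < z) ==> (m < x)%N) by [].
    by move: odd_x odd_m le_x; case: ltrP; case: ltrP; case: ltrP; lia.
  rewrite big1 // => s _; apply/eqP; rewrite pnatr_eq0 eqb0; apply/negP.
  case/and4P=> /eqP odd_x le_x lt_x _; move: cond odd_x odd_m lt_x; case: eqP => //=.
  by case: ltrP; case: ltrP; case: ltrP; lia.
rewrite (@sum_ranks_of_sign k (y < 0) (fun c => (uphalf m + (y < z)%R <= c)%N)
  (fun c => descsum y w (k - c))).
rewrite [RHS](big_ord_widen k.+1 (descsum y w)); last lia.
rewrite (reindex_inj rev_ord_inj) /=.
apply: eq_big => [i | i _]; have := ltn_ord i; last by move=> lti; congr descsum; lia.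
by move: odd_m; case: ltrP; case: ltrP; case: ltrP; lia.
Qed.

(** * The sorting order on letters *)

Section RankOrder.
Variables (n : nat) (r : 'I_n -> nat).

(** Ties are broken so as to create no descent: for indices $a < b$ of equal negative rank, the
    letter of [b] is the smaller one and comes first. *)
Definition rank_le (a b : 'I_n) : bool :=
  (r a < r b)%N || (r a == r b) && (if odd (r a) then b <= a else a <= b)%N.

Lemma rank_le_total : total rank_le.
Proof. by move=> a b; rewrite /rank_le; case: ltngtP => //= ->; case: odd; lia. Qed.

Lemma rank_le_trans : transitive rank_le.
Proof.
move=> b a c; rewrite /rank_le => /orP[lt_ab|/andP[/eqP-> le_ab]].
  by case/orP=> [lt_bc|/andP[/eqP<- _]]; rewrite ?lt_ab // (ltn_trans lt_ab lt_bc).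
case/orP=> [->//|/andP[-> le_bc]]; apply/orP; right.
by move: le_ab le_bc; case: odd; lia.
Qed.

Lemma rank_le_anti : antisymmetric rank_le.
Proof.
move=> a b; rewrite /rank_le; case: ltngtP => //= ->.
by case: odd => le_ab; apply: ord_inj; lia.
Qed.

Definition letter_fits (a : letter n) := odd (r a.2) == a.1.

Lemma letter_val_lt0 (a : letter n) : (letter_val a < 0) = a.1.
Proof. by case: a => [[] i]; rewrite /letter_val /= ?expr0 ?expr1; lia. Qed.

Lemma fits_letter_path a (ls : seq (letter n)) : letter_fits a ->
  fits (letter_val a) (r a.2) [seq letter_val b | b <- ls] [seq r b.2 | b <- ls]
    = all letter_fits ls && path rank_le a.2 [seq b.2 | b <- ls].
Proof.
elim: ls a => //= b ls IHls a fit_a; rewrite letter_val_lt0 -/(letter_fits b).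
case fit_b: (letter_fits b) => //=; rewrite {}IHls //.
rewrite andbA andbCA; congr (_ && _); congr (_ && _).
move: fit_a fit_b; rewrite /letter_fits /letter_val /rank_le.
case: a b => [sa i] [sb j] /= /eqP <- /eqP <-.
case: ltngtP => [| |<-] /=; rewrite ?implybT //.
by case: odd; rewrite ?expr0 ?expr1; lia.
Qed.

Lemma fits_letters (ls : seq (letter n)) :
  fits 0 0 [seq letter_val b | b <- ls] [seq r b.2 | b <- ls]
    = all letter_fits ls && sorted rank_le [seq b.2 | b <- ls].
Proof.
case: ls => //= b ls; rewrite letter_val_lt0 -/(letter_fits b).
case fit_b: (letter_fits b) => //=; rewrite fits_letter_path //.
(* The leading 0 has rank 0, and a negative first letter has odd, hence positive, rank. *)
suff -> : b.1 ==> (0 < r b.2)%N by [].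
by move: fit_b; rewrite /letter_fits; case: b.1 => // /eqP; case: (r b.2).
Qed.

End RankOrder.

(** * Signed permutations as words *)

Section Window.
Variables (n : nat) (p : {perm (letter n)}).
Hypothesis pB : p \in signed_perms n.

Definition letters : seq (letter n) := [seq p (false, i) | i <- enum 'I_n].

Lemma windowE : window p = [seq letter_val a | a <- letters].
Proof. by rewrite /letters -map_comp. Qed.

Lemma size_window : size (window p) = n.
Proof. by rewrite size_map size_enum_ord. Qed.

Lemma entryS (i : 'I_n) : entry p i.+1 = letter_val (p (false, i)).
Proof. by rewrite /entry /= (nth_map i) ?size_enum_ord // nth_ord_enum. Qed.

Lemma signed_permE (b : bool) i : p (b, i) = (b (+) (p (false, i)).1, (p (false, i)).2).
Proof.
case: b; last by case: (p _).
by move: pB; rewrite inE => /forallP/(_ (false, i))/eqP ->.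
Qed.

Definition abs_perm (i : 'I_n) : 'I_n := (p (false, i)).2.

Lemma abs_perm_inj : injective abs_perm.
Proof.
move=> i j eq_ij; have [b] : exists b, p (b, i) = p (false, j).
  (* This sign turns $\pi_i$ into $\pi_j$, so injectivity of [p] applies. *)
  exists ((p (false, i)).1 (+) (p (false, j)).1); rewrite signed_permE.
  rewrite -/(abs_perm i) eq_ij /abs_perm; case: (p (false, j)) => x y /=.
  by rewrite addbC addbA addbb.
by move/perm_inj => -[].
Qed.

Lemma abs_letters : [seq a.2 | a <- letters] = [seq abs_perm i | i <- enum 'I_n].
Proof. by rewrite /letters -map_comp. Qed.

Lemma ndes_window : ndes 0 (window p) = des_B p.
Proof.
rewrite /des_B cardsE -sum1_card big_mkcond /= /entry.
suff H (z : int) w :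
    (\sum_(i < size w) (if ((z :: w)`_i.+1 < (z :: w)`_i)%R then 1 else 0))%N = ndes z w.
  by rewrite -H size_window.
elim: w z => [|y w IHw] z; first by rewrite big_ord0.
by rewrite [LHS]big_ord_recl /= -IHw; case: (y < z).
Qed.

End Window.

(** * The signed permutation determined by a vector of ranks *)

Section Sorting.
Variables (n : nat) (r : 'I_n -> nat).

(** The ordinals sorted are coordinates of the vector, that is, absolute values of letters; they
    become $|\pi_1|, \dots, |\pi_n|$. *)
Definition sorted_pos : n.-tuple 'I_n := [tuple of sort (rank_le r) (ord_tuple n)].

Definition sort_letter (a : letter n) : letter n :=
  (a.1 (+) odd (r (tnth sorted_pos a.2)), tnth sorted_pos a.2).

Lemma sort_letter_inj : injective sort_letter.
Proof.
have uniq_s : uniq sorted_pos by rewrite sort_uniq val_ord_tuple enum_uniq.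
move=> [b i] [c j] [] /= eq_bc /(tuple_uniqP _ uniq_s) eq_ij.
by move: eq_bc; rewrite eq_ij => /addIb ->.
Qed.

Definition sort_perm : {perm (letter n)} := perm sort_letter_inj.

Lemma sort_perm_signed : sort_perm \in signed_perms n.
Proof. by rewrite inE; apply/forallP => a; rewrite !permE /sort_letter /= addNb. Qed.

Definition fits_perm (p : {perm (letter n)}) :=
  fits 0 0 (window p) [seq r (abs_perm p i) | i <- enum 'I_n].

Lemma fits_permE p : fits_perm p =
  all (letter_fits r) (letters p) && sorted (rank_le r) [seq abs_perm p i | i <- enum 'I_n].
Proof. by rewrite -abs_letters -fits_letters -windowE -map_comp. Qed.

(** Sorting by an antisymmetric order has a unique result, which fixes the absolute values; the
    parities of the ranks then fix the signs. *)
Lemma fits_sort_perm p : p \in signed_perms n -> fits_perm p = (p == sort_perm).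
Proof.
move=> pB; rewrite fits_permE; apply/andP/eqP => [[/allP fit_p sort_p] | ->].
  have eq_s : [seq abs_perm p i | i <- enum 'I_n] = sorted_pos.
    apply: (sorted_eq (@rank_le_trans _ r) (@rank_le_anti _ r)) => //.
      exact/sort_sorted/rank_le_total.
    rewrite perm_sym perm_sort val_ord_tuple perm_sym uniq_perm ?enum_uniq //.
      by rewrite map_inj_uniq ?enum_uniq //; apply: abs_perm_inj.
    move=> a; rewrite mem_enum; apply/mapP.
    have [g _ gK] := injF_bij (abs_perm_inj pB).
    by exists (g a); rewrite ?mem_enum ?gK.
  have eq_abs i : abs_perm p i = tnth sorted_pos i.
    rewrite (tnth_nth i) -eq_s (nth_map i) ?size_enum_ord ?nth_ord_enum //.
  apply/permP => -[b i]; rewrite permE /sort_letter /= -eq_abs signed_permE //.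
  by congr (_ (+) _, _); apply/esym/eqP/fit_p/map_f/mem_enum.
have eq_abs i : abs_perm sort_perm i = tnth sorted_pos i by rewrite /abs_perm permE.
split; last first.
  rewrite (eq_map eq_abs) map_tnth_enum; exact/sort_sorted/rank_le_total.
by apply/allP => _ /mapP[i _ ->]; rewrite /letter_fits permE /=.
Qed.

Lemma sum_fits_perm (w : {perm (letter n)} -> rat) :
  \sum_(p in signed_perms n) w p * (fits_perm p)%:R = w sort_perm.
Proof.
rewrite (bigD1 sort_perm) ?sort_perm_signed //= fits_sort_perm ?sort_perm_signed //.
rewrite eqxx mulr1 big1 ?addr0 // => p /andP[pB /negPf neq_p].
by rewrite fits_sort_perm // neq_p mulr0.
Qed.

(** Replaces the order of positions by that of ranks, so that inversions can be counted over pairs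
    of coordinates. *)
Lemma fits_abs_perm_lt p (i j : 'I_n) : fits_perm p -> p \in signed_perms n ->
  (i < j)%N = (i != j) && rank_le r (abs_perm p i) (abs_perm p j).
Proof.
rewrite fits_permE => /andP[_ sort_p] pB.
have le_rank (i' j' : 'I_n) : (i' < j')%N -> rank_le r (abs_perm p i') (abs_perm p j').
  have := sorted_ltn_nth (@rank_le_trans _ r) (abs_perm p i') sort_p.
  have nth_abs (l : 'I_n) x0 : nth x0 [seq abs_perm p m | m <- enum 'I_n] l = abs_perm p l.
    by rewrite (nth_map l) ?size_enum_ord // nth_ord_enum.
  move=> /(_ i' j'); rewrite !inE size_map size_enum_ord !ltn_ord !nth_abs.
  exact.
case: ltngtP => [lt_ij | lt_ji | /ord_inj ->]; last by rewrite eqxx.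
  by rewrite le_rank // -val_eqE /= ltn_eqF.
apply/esym/negbTE/negP => /andP[neq_ij le_ij]; case/eqP: neq_ij.
by apply/(abs_perm_inj pB)/(rank_le_anti (r := r)); rewrite le_ij le_rank.
Qed.

End Sorting.

(* Whether letter b, carrying rank y, precedes letter a < b, carrying rank x, in the
   sorted word: letters of equal negative value appear in decreasing order. *)
Definition inverted (x y : nat) : bool := (y < x)%N || (x == y) && odd x.

Lemma rank_le_inverted n (r : 'I_n -> nat) (a b : 'I_n) :
  (a < b)%N -> rank_le r b a = inverted (r a) (r b).
Proof. by rewrite /rank_le /inverted => lt_ab; case: ltngtP => //= ->; case: odd; lia. Qed.

(** * The statistics in terms of ranks *)

Section Statistics.
Variables (R : comPzRingType) (u : R).
Hypothesis u2 : u ^+ 2 = 1.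

(* For i < j exactly one of pi_i > pi_j and - pi_i > pi_j holds if |pi_i| > |pi_j|,
   and none or both hold otherwise. *)
Lemma expr_inv_D n (p : {perm (letter n)}) : p \in signed_perms n ->
  u ^+ inv_D p =
  \prod_(ij : 'I_n * 'I_n | (ij.1 < ij.2)%N && (abs_perm p ij.2 < abs_perm p ij.1)%N) u.
Proof.
move=> pB; rewrite exprD -!prodr_const.
under eq_bigl => ij do rewrite inE !entryS.
under [X in _ * X]eq_bigl => ij do rewrite inE !entryS.
rewrite !big_mkcondr -big_split /=; apply: eq_bigr => -[i j] /= lt_ij.
have: abs_perm p i != abs_perm p j.
  by rewrite (inj_eq (abs_perm_inj pB)) -val_eqE /= ltn_eqF.
rewrite -val_eqE /abs_perm; case: (p (false, i)) (p (false, j)) => [a x] [b y] /=.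
rewrite /letter_val /=; case: a b => [] []; rewrite ?expr0 ?expr1 ?mul1r ?mulN1r ?opprK;
  case: ltngtP => // lt_xy _; do !case: ifP => ?; rewrite ?mulr1 ?mul1r -?expr2 ?u2 //; lia.
Qed.

(** [abs_perm] carries pairs of positions to pairs of absolute values; inversions become the pairs
    $a < b$ with [b] placed before [a]. *)
Lemma expr_inv_D_fits n (r : 'I_n -> nat) p : p \in signed_perms n -> fits_perm r p ->
  u ^+ inv_D p = \prod_(a < n) \prod_(b < n | (a < b)%N) u ^+ inverted (r a) (r b).
Proof.
move=> pB fit_p; rewrite expr_inv_D // pair_big_dep /=.
transitivity (\prod_(ij : 'I_n * 'I_n | (ij.2 < ij.1)%N && rank_le r ij.1 ij.2) u).
  rewrite [RHS](reindex (fun ij => (abs_perm p ij.1, abs_perm p ij.2))) /=; last first.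
    have [g gK Kg] := injF_bij (abs_perm_inj pB).
    by exists (fun ij => (g ij.1, g ij.2)) => -[i j] _; rewrite /= ?gK ?Kg.
  apply: eq_bigl => -[i j] /=; rewrite (fits_abs_perm_lt _ _ fit_p) //.
  by case: eqP => [->|_]; rewrite ?ltnn //= andbC.
rewrite (reindex_inj (h := fun ij => (ij.2, ij.1))) /=; last by move=> [a b] [c d] [-> ->].
rewrite big_mkcondr /=; apply: eq_bigr => -[a b] /= lt_ab.
by rewrite rank_le_inverted //; case: inverted; rewrite ?expr0 ?expr1.
Qed.

Lemma expr_negs_fits n (r : 'I_n -> nat) p : p \in signed_perms n -> fits_perm r p ->
  u ^+ negs p = \prod_(a < n) u ^+ odd (r a).
Proof.
move=> pB; rewrite fits_permE => /andP[/allP fit_p _].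
rewrite (reindex_inj (abs_perm_inj pB)) -prodr_const big_mkcond /=.
apply: eq_bigr => i _; rewrite inE entryS letter_val_lt0.
have /eqP := fit_p _ (map_f _ (mem_enum _ i)); rewrite -/(abs_perm p i) => ->.
by case: (p _).1; rewrite ?expr0 ?expr1.
Qed.

End Statistics.

(** * Character sums as sums over rank vectors *)

Section RankWeight.
Variables u q : rat.

(** The recursive form lets coordinates be removed from the front. *)
Fixpoint rank_weight (s : seq nat) : rat :=
  if s is x :: s' then
    q ^+ odd x * (\prod_(y <- s') u ^+ inverted x y) * rank_weight s'
  else 1.

Lemma rank_weightE n s : size s = n -> rank_weight s =
  (\prod_(a < n) \prod_(b < n | (a < b)%N) u ^+ inverted (nth 0%N s a) (nth 0%N s b)) *
  (\prod_(a < n) q ^+ odd (nth 0%N s a)).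
Proof.
move=> <- {n}; elim: s => [|x s IHs] /=; first by rewrite !big_ord0 mulr1.
have shift m (F : nat -> rat) a :
    \prod_(b < m.+1 | (a < b)%N) F b = \prod_(b < m | (a <= b)%N) F b.+1.
  by rewrite big_mkcond big_ord_recl /= mul1r [RHS]big_mkcond.
rewrite !big_ord_recl (shift _ (fun b => u ^+ inverted x (nth 0%N (x :: s) b))) {}IHs.
under [X in _ = _ * X * _]eq_bigr => i _ do
  rewrite (shift _ (fun b => u ^+ inverted (nth 0%N (x :: s) _) (nth 0%N (x :: s) b))).
by rewrite (big_nth 0%N) big_mkord /=; ring.
Qed.

Hypothesis u2 : u ^+ 2 = 1.

(** Each rank vector fits exactly one signed permutation, so after exchanging the sums a single term
    per vector remains, and its weight is a function of the ranks. *)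
Lemma sum_signed_perms n k :
  \sum_(p in signed_perms n) (u ^+ inv_D p * q ^+ negs p) * descsum 0 (window p) k =
  \sum_(r : n.-tuple 'I_k.*2.+1) rank_weight (map val r).
Proof.
have count p : p \in signed_perms n -> descsum 0 (window p) k =
    \sum_(r : n.-tuple 'I_k.*2.+1) (fits_perm (fun i => val (tnth r i)) p)%:R.
  move=> pB; transitivity
      (\sum_(s : n.-tuple 'I_k.*2.+1) (fits 0 0 (window p) (map val s))%:R : rat).
    by rewrite -{1}[k]subn0 -(@count_fits _ _ 0) // size_window.
  (* [s] lists the ranks in word order, [r] by absolute value; [abs_perm] and its inverse [g] pass
     between them. *)
  have [g gK Kg] := injF_bij (abs_perm_inj pB).
  rewrite (reindex (fun r : n.-tuple 'I_k.*2.+1 => [tuple tnth r (abs_perm p i) | i < n])).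
    by apply: eq_bigr => r _; rewrite /fits_perm /= -map_comp.
  exists (fun r => [tuple tnth r (g i) | i < n]) => r _; apply: eq_from_tnth => i.
    by rewrite !tnth_mktuple Kg.
  by rewrite !tnth_mktuple gK.
under eq_bigr => p pB do rewrite count // mulr_sumr.
rewrite exchange_big; apply: eq_bigr => r _ /=; rewrite sum_fits_perm.
set f := fun i => val (tnth r i); have fB := sort_perm_signed f.
have fit_f : fits_perm f (sort_perm f) by rewrite fits_sort_perm.
rewrite (expr_inv_D_fits u2 fB fit_f) (expr_negs_fits q fB fit_f).
rewrite (@rank_weightE n) ?size_map ?size_tuple //.
have fE (i : 'I_n) : nth 0%N (map val r) i = f i by rewrite -tnth_nth tnth_map.
congr (_ * _); first by apply: eq_bigr => a _; apply: eq_bigr => b _; rewrite !fE.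
by apply: eq_bigr => a _; rewrite fE.
Qed.

Lemma sum_rank1 k : \sum_(x < k.*2.+1) q ^+ odd x = k%:R + 1 + q * k%:R.
Proof.
elim: k => [|k IHk]; first by rewrite big_ord1 mulr0 addr0 add0r.
rewrite doubleS 2!big_ord_recr /= {}IHk odd_double /= expr0 expr1.
by rewrite -natr1; ring.
Qed.

End RankWeight.

(** * Evaluation of the sums over rank vectors *)

Lemma sum_rank_weight_unsigned q n k :
  \sum_(r : n.-tuple 'I_k.*2.+1) rank_weight 1 q (map val r) = (k%:R + 1 + q * k%:R) ^+ n.
Proof.
elim: n => [|n IHn].
  by rewrite (eq_bigr (fun=> 1)) => [|r _]; rewrite ?tuple0 // sumr_const card_tuple.
rewrite sum_tuple_cons exprS -IHn -sum_rank1 mulr_suml; apply: eq_bigr => x _.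
rewrite mulr_sumr; apply: eq_bigr => r _ /=.
by rewrite big1 ?mulr1 // => y _; rewrite expr1n.
Qed.

Lemma inverted_sign x y : x != y -> (-1) ^+ inverted x y = - (-1) ^+ inverted y x :> rat.
Proof.
by rewrite /inverted; case: ltngtP => //= _ _; rewrite expr0 expr1 ?opprK.
Qed.

(* Exchanging the first two ranks changes the sign of the weight unless they are equal. *)
Lemma sum_rank_weight_signedSS q n k : q ^+ 2 = 1 ->
  \sum_(r : n.+2.-tuple 'I_k.*2.+1) rank_weight (-1) q (map val r) =
  \sum_(r : n.-tuple 'I_k.*2.+1) rank_weight (-1) q (map val r).
Proof.
move=> q2; rewrite sum_tuple_cons.
under eq_bigr => x _ do rewrite sum_tuple_cons exchange_big /=.
rewrite exchange_big; apply: eq_bigr => r _ /=.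
set w := rank_weight _ _ _.
(* The factors tying one of the first two coordinates to the remaining ones. *)
pose a (x : 'I_k.*2.+1) := q ^+ odd x * \prod_(y <- map val r) (-1) ^+ inverted x y.
transitivity (\sum_(x < k.*2.+1) \sum_(y < k.*2.+1) (-1) ^+ inverted x y * (a x * a y * w)).
  apply: eq_bigr => x _; apply: eq_bigr => y _; rewrite big_cons /a; ring.
have a2 x : a x * a x = 1.
  rewrite -expr2 exprMn -exprM mulnC exprM q2 expr1n mul1r -prodrXl.
  by apply: big1 => y _; rewrite -exprM mulnC exprM sqrrN !expr1n.
(* The terms with distinct ranks; exchanging [x] and [y] gives $T = -T$. *)
pose T := \sum_(x < k.*2.+1) \sum_(y < k.*2.+1 | y != x)
  (-1) ^+ inverted x y * (a x * a y * w).
have T0 : T = 0.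
  suff: T = - T by lra.
  rewrite {1}/T (exchange_big_dep predT) //= /T -sumrN; apply: eq_bigr => x _.
  rewrite -sumrN; apply: eq_big => [y | y neq_xy]; first by rewrite eq_sym.
  by rewrite inverted_sign; [ring | rewrite val_eqE eq_sym].
(* On the diagonal [inverted x x] is [odd x], and the signs add up to $(k+1) - k = 1$. *)
transitivity (\sum_(x < k.*2.+1) (-1) ^+ odd x * w + T).
  rewrite /T -big_split; apply: eq_bigr => x _ /=.
  by rewrite (bigD1 x) //= a2 mul1r /inverted ltnn eqxx.
by rewrite T0 addr0 -mulr_suml sum_rank1; ring.
Qed.

Lemma sum_rank_weight_signed q n k : q ^+ 2 = 1 ->
  \sum_(r : n.-tuple 'I_k.*2.+1) rank_weight (-1) q (map val r) =
  if odd n then k%:R + 1 + q * k%:R else 1.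
Proof.
move=> q2; elim/ltn_ind: n => -[|[|n]] IHn.
- by rewrite (eq_bigr (fun=> 1)) => [|r _]; rewrite ?tuple0 // sumr_const card_tuple.
- rewrite sum_tuple_cons -sum_rank1; apply: eq_bigr => x _.
  rewrite (eq_bigr (fun=> q ^+ odd x)) => [|r _].
    by rewrite sumr_const card_tuple.
  by rewrite tuple0 /= big_nil !mulr1.
- by rewrite sum_rank_weight_signedSS //= IHn // negbK.
Qed.

(** * The four character sums and the theorem *)

(** This is the coefficient at $t^k$ of $\sum_\pi u^{inv_D(\pi)} q^{negs(\pi)} t^{des_B(\pi)} /
    (1-t)^{n+1}$. *)
Definition char_sum n (u q : rat) (k : nat) : rat :=
  \sum_(p in signed_perms n) (u ^+ inv_D p * q ^+ negs p) * descsum 0 (window p) k.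

Lemma char_sum_unsigned n q k : char_sum n 1 q k = (k%:R + 1 + q * k%:R) ^+ n.
Proof. by rewrite /char_sum sum_signed_perms ?expr1n // sum_rank_weight_unsigned. Qed.

Lemma char_sum_signed n q k : q ^+ 2 = 1 ->
  char_sum n (-1) q k = if odd n then k%:R + 1 + q * k%:R else 1.
Proof.
by move=> q2; rewrite /char_sum sum_signed_perms ?sqrrN ?expr1n // sum_rank_weight_signed.
Qed.

Lemma odd_indicator m (b : bool) :
  (odd m == b)%:R = 1 / 2 * (1 + (-1) ^+ b * (-1) ^+ m) :> rat.
Proof.
by rewrite -(signr_odd _ m); case: (odd m); case: b;
   rewrite /= ?expr0 ?expr1; lra.
Qed.

(** Each of the two parity conditions has indicator $(1 \pm (-1)^m)/2$; the product of the two
    expands into four characters with the factor 1/4. *)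
Lemma fps_div_with_sign n (s e : bool) (A : {set {perm (letter n)}}) k :
    (forall p, (p \in A) = (p \in signed_perms n) && (odd (negs p) == e)) ->
  fps_div (fps_of_poly (\sum_(p in with_sign s A) 'X ^+ des_B p : {poly rat}))
          (fps_of_poly ((1 - 'X) ^+ n.+1)) k =
  1 / 4 * (char_sum n 1 1 k + (-1) ^+ e * char_sum n 1 (-1) k +
           (-1) ^+ s * (char_sum n (-1) 1 k + (-1) ^+ e * char_sum n (-1) (-1) k)).
Proof.
move=> AE.
have -> : \sum_(p in with_sign s A) 'X ^+ des_B p =
    \sum_(p in signed_perms n)
      ((odd (negs p) == e)%:R * (odd (inv_D p) == s)%:R) *: 'X ^+ des_B p :> {poly rat}.
  rewrite [RHS](bigID (mem (with_sign s A))) /= [X in _ + X]big1 ?addr0.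
    apply: eq_big => p; rewrite inE AE; first by case: (_ \in _); rewrite // andbT.
    by case/andP=> /andP[_ /eqP->] /eqP->; rewrite !eqxx mulr1 scale1r.
  move=> p /andP[pB]; rewrite inE AE pB /=.
  by do 2!case: eqP => _; rewrite ?mul0r ?mulr0 ?scale0r.
rewrite fps_div_sum /char_sum !mulr_sumr -!big_split mulr_sumr -big_split mulr_sumr.
apply: eq_bigr => p pB; rewrite /= -ndes_window.
have := fps_div_descsum 0 (window p) k; rewrite size_window => ->.
by rewrite !odd_indicator !expr1n; field.
Qed.

Unset Implicit Arguments.

Theorem theorem6p7 (n : nat) (n_gt0 : (0 < n)%N) (s : bool) :
  (fps_div (fps_of_poly (BDesD n s)) (fps_of_poly ((1 - 'X) ^+ n.+1))
   =1 fun k : nat =>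
        if ~~ odd n then
          1 / 2 * (1 / 2 * ((2 * k%:R + 1) ^+ n + 1) + (-1) ^+ s * 1)
        else
          1 / 2 * (1 / 2 * ((2 * k%:R + 1) ^+ n + 1) + (-1) ^+ s * (k%:R + 1)))
  /\
  (fps_div (fps_of_poly (BDesBD n s)) (fps_of_poly ((1 - 'X) ^+ n.+1))
   =1 fun k : nat =>
        if ~~ odd n then
          1 / 2 * (1 / 2 * ((2 * k%:R + 1) ^+ n - 1))
        else
          1 / 2 * (1 / 2 * ((2 * k%:R + 1) ^+ n - 1) + (-1) ^+ s * k%:R)).
Proof.
have one2 : 1 ^+ 2 = 1 :> rat by rewrite expr1n.
have mone2 : (-1) ^+ 2 = 1 :> rat by rewrite sqrrN expr1n.
have unsigned k : char_sum n 1 1 k = (2 * k%:R + 1) ^+ n.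
  by rewrite char_sum_unsigned; congr (_ ^+ n); ring.
have unsignedN k : char_sum n 1 (-1) k = 1.
  rewrite char_sum_unsigned -[RHS](expr1n _ n); congr (_ ^+ n); ring.
split=> k.
  (* The signed sums for $q = 1, -1$ are both 1 for even $n$, and $2k+1$ and 1 for odd $n$. Their
     sum serves $D$, their difference $B - D$. *)
  rewrite (@fps_div_with_sign _ _ false) => [|p]; last by rewrite inE eqbF_neg.
  by rewrite unsigned unsignedN !char_sum_signed //; case: odd => /=; field.
rewrite (@fps_div_with_sign _ _ true) => [|p]; last first.
  by rewrite !inE eqb_id andbC; case: forallP => //= _; rewrite negbK.
by rewrite unsigned unsignedN !char_sum_signed //; case: odd => /=; field.
Qed.
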